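(* Let $X_1,\dots,X_d$ be $\sigma$-finite measure spaces and suppose $f\in L^2(X_1\times\dots\times X_d)$ has a decomposition $$f=\sum_{p=1}^r\lambda_p\,\varphi_{1p}\otimes\dots\otimes\varphi_{dp}$$ with nonzero coefficients $\lambda_p\in\mathbb{C}$, where for each $k$ the set $\Phi_k=\{\varphi_{k1},\dots,\varphi_{kr}\}\subseteq L^2(X_k)$ consists of unit-norm elements and $\operatorname{krank}\Phi_k<\dim\operatorname{span}\Phi_k$. Let $\mu_k=\mu(\Phi_k)$ and $\omega_k=\omega(\Phi_k)=(1-\mu_k)/\mu_k$. If $$\sum_{k=1}^d\omega_k\ge 2r-1,$$ equivalently $\sum_{k=1}^d 1/\mu_k\ge 2r+d-1$, then $r=\operatorname{rank}(f)$ and the decomposition is essentially unique.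
   Context: $\varphi_1\otimes\dots\otimes\varphi_d$ denotes $(\mathbf{x}_1,\dots,\mathbf{x}_d)\mapsto\prod_k\varphi_k(\mathbf{x}_k)$. $\operatorname{rank}(f)$ is the minimal number of such tensor products summing to $f$. Kruskal rank $\operatorname{krank}\Phi$: the largest $k$ such that every $k$-element subset of $\Phi$ is linearly independent. Coherence: $\mu(\Phi)=\max_{\varphi\ne\psi\in\Phi}\lvert\langle\varphi,\psi\rangle\rvert$. Essentially unique: for any other decomposition $f=\sum_{p=1}^r\lambda'_p\psi_{1p}\otimes\dots\otimes\psi_{dp}$ with unit-norm factors, after a relabelling of the terms one has $\lambda'_p\psi_{1p}\otimes\dots\otimes\psi_{dp}=\lambda_p\varphi_{1p}\otimes\dots\otimes\varphi_{dp}$ for every $p$, i.e. the factors agree up to unimodular scalars (whose product compensates the coefficients) and the terms agree up to permutation; in normalized form (coefficients real with $\lambda_1\ge\dots\ge\lambda_r>0$) this means equal coefficients and factors equal up to unimodular scalars whose phases sum to $0 \bmod 2\pi$, with relabelling only within blocks of equal coefficients. *)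

(* Defs.v *)
From HB Require Import structures.
From mathcomp Require Import all_boot all_order all_algebra all_fingroup.
From mathcomp Require Import all_classical all_reals all_analysis.
From mathcomp Require Import complex.
Set Implicit Arguments. Unset Strict Implicit. Unset Printing Implicit Defensive.
Import Order.TTheory GRing.Theory Num.Theory.
Import numFieldNormedType.Exports.
Local Open Scope classical_set_scope.
Local Open Scope ring_scope.

(* Elements of L^2 are represented by functions T -> R[i]; equality in  *)
(* L^2 is equality almost everywhere, i.e. the L^2 norm of the          *)
(* difference vanishes.                                                 *)
Section L2one.
Context (R : realType) (disp : measure_display) (T : measurableType disp)
        (mu : {measure set T -> \bar R}).

Definition csqabs (z : R[i]) : R := (complex.Re z) ^+ 2 + (complex.Im z) ^+ 2.

Definition L2sqnorm (phi : T -> R[i]) : \bar R := (\int[mu]_x (csqabs (phi x))%:E)%E.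

Definition inL2 (phi : T -> R[i]) : Prop :=
  [/\ measurable_fun setT (fun x => complex.Re (phi x)),
      measurable_fun setT (fun x => complex.Im (phi x)) &
      (L2sqnorm phi < +oo)%E].

(* L2inner product <phi, psi> = \int phi * conj psi *)
Definition L2inner (phi psi : T -> R[i]) : R[i] :=
  Complex
    (Rintegral mu setT (fun x => complex.Re (phi x) * complex.Re (psi x) + complex.Im (phi x) * complex.Im (psi x)))
    (Rintegral mu setT (fun x => complex.Im (phi x) * complex.Re (psi x) - complex.Re (phi x) * complex.Im (psi x))).

Variable r : nat.
Implicit Type Phi : 'I_r -> T -> R[i].

Definition L2lin_indep (S : {set 'I_r}) Phi : Prop :=
  forall c : 'I_r -> R[i],
    L2sqnorm (fun x => \sum_(p in S) c p * Phi p x) = 0%E ->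
    forall p, p \in S -> c p = 0.

Definition L2krank Phi : nat :=
  \max_(k < r.+1 | `[< forall S : {set 'I_r}, #|S| = k -> L2lin_indep S Phi >]) k.

Definition L2dim_span Phi : nat :=
  \max_(S : {set 'I_r} | `[< L2lin_indep S Phi >]) #|S|.

Definition L2coherence Phi : R :=
  \big[Num.max/0]_(p < r) \big[Num.max/0]_(q < r | p != q)
     Normc.normc (L2inner (Phi p) (Phi q)).

Definition L2omega Phi : R := (1 - L2coherence Phi) / L2coherence Phi.

End L2one.

Section Product.
Context (R : realType) (d : nat) (disp : 'I_d -> measure_display)
        (T : forall k : 'I_d, measurableType (disp k))
        (mu : forall k : 'I_d, {measure set T k -> \bar R}).

Definition prodT := forall k : 'I_d, T k.

Fixpoint iint (s : seq 'I_d) (F : prodT -> \bar R) (x : prodT) : \bar R :=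
  match s with
  | [::] => F x
  | k :: s' => (\int[mu k]_y iint s' F (@dfwith _ (fun j => T j) x k y))%E
  end.

(* squared L^2(X_1 x ... x X_d) norm, computed by Tonelli as an iterated integral *)
Definition prod_sqnorm (F : prodT -> R[i]) : \bar R :=
  iint (enum 'I_d) (fun x => (csqabs (F x))%:E) (fun k => point).

Definition L2eq (F G : prodT -> R[i]) : Prop := prod_sqnorm (fun x => F x - G x) = 0%E.

Definition tensor (lam : R[i]) (phi : forall k : 'I_d, T k -> R[i]) : prodT -> R[i] :=
  fun x => lam * \prod_(k < d) phi k (x k).

Definition tsum (r : nat) (lam : 'I_r -> R[i])
    (phi : forall k : 'I_d, 'I_r -> T k -> R[i]) : prodT -> R[i] :=
  fun x => \sum_(p < r) tensor (lam p) (fun k => phi k p) x.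

End Product.

(* Main.v *)
(** Linear algebra heart (after Lovitz and Petrov): let T, |T| >= 2, be a set of
    product tensors with zero sum and no proper nonempty subset of zero sum.
    Then sum_k (dim span_k T - 1) <= |T| - 2, where span_k is the span of the
    k-th factors.  Grow S from a singleton to T: if no nonempty Q in T \ S
    satisfies sum_k (dim span_k (S u Q) - dim span_k S) < |Q|, Rado's theorem
    splits T \ S into sets Q_k linearly independent modulo span_k S; the tensor
    product of the projections onto span_k S along span Q_k fixes S and kills
    T \ S, so S has zero sum, a contradiction.

    Subtract two decompositions and cut the difference into minimal zero-sum
    sets.  A set with p old and q <= p new terms, p >= 2, would have
    sum_k (min(krank_k, p) - 1) <= p + q - 2 <= 2p - 2, which the hypothesis
    sum_k (krank_k - 1) >= 2r - 1 forbids; hence by counting every set pairs one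
    old term with one new one.  A Gershgorin estimate on a dependent family of
    krank_k + 1 functions gives omega_k <= krank_k - 1.

    The L^2 norm of a sum of product functions depends only on the Gram matrices
    of the factors, so functions may be replaced by vectors realizing these. *)
Require Import Defs.
From HB Require Import structures.
From mathcomp Require Import all_boot all_order all_algebra all_fingroup.
From mathcomp Require Import zify ring lra.
Set Implicit Arguments. Unset Strict Implicit. Unset Printing Implicit Defensive.
Import Order.TTheory GRing.Theory Num.Theory.
Local Open Scope ring_scope.

(** * Minimal zero-sum sets of product tensors *)

(** Rado's theorem on independent transversals. The offset [w] allows contraction: it is meant to be
    the rank of the contracted set, and ranks count only above it. *)
Lemma rado (E I : finType) (rk : {set E} -> nat) (w : nat) (Q : {set I}) :
  {homo rk : A B / A \subset B >-> (A <= B)%N} ->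
  (forall A B, rk (A :|: B) + rk (A :&: B) <= rk A + rk B)%N ->
  forall A : I -> {set E},
  (forall J : {set I}, J \subset Q -> #|J| + w <= rk (\bigcup_(i in J) A i))%N ->
  exists B : I -> {set E}, [/\ forall i, B i \subset A i,
    {in Q, forall i, #|B i| <= 1}%N &
    forall J : {set I}, J \subset Q -> (#|J| + w <= rk (\bigcup_(i in J) B i))%N].
Proof.
(* Shrink a set A i containing x <> y: if deleting x and deleting y both broke
   the rank condition, submodularity on the two violating unions would refute
   the condition for A itself. *)
move=> mono submod A; have [n] := ubnP (\sum_(i in Q) #|A i|).
elim: n A => // n IHn A leAn hA.
have [small|] := boolP [forall i in Q, #|A i| <= 1]%N.
  by exists A; split=> // i iQ; move/forall_inP: small; apply.
rewrite negb_forall_in => /exists_inP[i iQ]; rewrite -ltnNge.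
move=> /card_gt1P[x [y [xA yA neqxy]]].
pose rem z := fun k => if k == i then A i :\ z else A k.
have remS z k : rem z k \subset A k.
  by rewrite /rem; case: eqP => // ->; rewrite subD1set.
have remE z k : k != i -> rem z k = A k by rewrite /rem => /negbTE ->.
have IHr z : z \in A i ->
    (forall J : {set I}, J \subset Q -> #|J| + w <= rk (\bigcup_(i in J) rem z i))%N ->
    exists B : I -> {set E}, [/\ forall i, B i \subset A i,
    {in Q, forall i, #|B i| <= 1}%N &
    forall J : {set I}, J \subset Q -> (#|J| + w <= rk (\bigcup_(i in J) B i))%N].
  move=> zA /IHn[|B [BS B1 hB]].
    apply: leq_trans (leAn : _ <= n)%N; rewrite (bigD1 i iQ)/= [ltnRHS](bigD1 i iQ)/=.
    rewrite {1}/rem eqxx (cardsD1 z (A i)) zA.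
    rewrite (eq_bigr (fun k => #|A k|)) => [|k /andP[_ ki]]; last by rewrite remE.
    by rewrite add1n addSn.
  by exists B; split=> // k; apply: subset_trans (BS k) (remS z k).
(* A union over a [J] without [i] is unaffected by the deletion, so a violating [J] contains [i]. *)
have bad z (J : {set I}) : ~ (J \subset Q -> #|J| + w <= rk (\bigcup_(i in J) rem z i))%N ->
    [/\ J \subset Q, i \in J & rk (\bigcup_(i in J) rem z i) < #|J| + w]%N.
  move=> nJ; have JQ : J \subset Q by apply/negPn/negP => /negP JQ; apply: nJ => /JQ.
  split=> //; last by rewrite ltnNge; apply/negP => hJ; apply: nJ.
  apply/negPn/negP => iJ; apply: nJ => _.
  rewrite (eq_bigr A) => [|k kJ]; [exact: hA|apply: remE].
  by apply: contraNneq iJ => <-.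
have [/forallP hx|] := boolP [forall J : {set I},
    (J \subset Q) ==> (#|J| + w <= rk (\bigcup_(i in J) rem x i))%N].
  by apply: (IHr x) => // J; apply/implyP.
have [/forallP hy _|] := boolP [forall J : {set I},
    (J \subset Q) ==> (#|J| + w <= rk (\bigcup_(i in J) rem y i))%N].
  by apply: (IHr y) => // J; apply/implyP.
move=> /forallPn[J2 /negP n2] /forallPn[J1 /negP n1]; exfalso.
have [J2Q iJ2 hJ2] := bad y J2 (fun h => n2 (introT implyP h)).
have [J1Q iJ1 hJ1] := bad x J1 (fun h => n1 (introT implyP h)).
set X := \bigcup_(k in J1) _ in hJ1; set Y := \bigcup_(k in J2) _ in hJ2.
have XY := submod X Y.
have hU : (#|J1 :|: J2| + w <= rk (X :|: Y))%N.
  apply: leq_trans (hA _ _) (mono _ _ _); first by rewrite subUset J1Q.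
  apply/bigcupsP => k; rewrite inE => kJ; have [->|ki] := eqVneq k i.
    apply/fintype.subsetP => t tA; rewrite inE; have [tx|tx] := eqVneq t x.
      by apply/orP; right; apply/bigcupP; exists i; rewrite // /rem eqxx !inE tx neqxy.
    by apply/orP; left; apply/bigcupP; exists i; rewrite // /rem eqxx !inE tx.
  case/orP: kJ => kJ.
    by apply: subset_trans (subsetUl _ _); rewrite -(remE x k ki) (bigcup_sup k).
  by apply: subset_trans (subsetUr _ _); rewrite -(remE y k ki) (bigcup_sup k).
(* At [i] the intersection keeps only [A i] without [x] and [y], so [i] is dropped from [J1 :&: J2].
   This costs one, while the two strict violations gain two. *)
have hI : (#|(J1 :&: J2) :\ i| + w <= rk (X :&: Y))%N.
  apply: leq_trans (hA _ _) (mono _ _ _).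
    by rewrite (subset_trans (subD1set _ _))// (subset_trans (subsetIl _ _)).
  apply/bigcupsP => k; rewrite !inE => /and3P[ki k1 k2].
  by rewrite subsetI -{1}(remE x k ki) -(remE y k ki) !(bigcup_sup k).
have := cardsUI J1 J2; have := cardsD1 i (J1 :&: J2); rewrite inE iJ1 iJ2 /=.
lia.
Qed.

Section ZeroSum.
Variables (F : fieldType) (d N : nat) (E : finType).
Variables (v : 'I_d -> E -> 'rV[F]_N) (c : E -> F).
Implicit Types S T Q : {set E}.

Definition modespan j S := (\sum_(e in S) <<v j e>>)%MS.

(* The tensor sum over S of c e * (v 0 e (x) v 1 e (x) ...) vanishes,
   coordinate by coordinate. *)
Definition zerosum S := [forall i : {ffun 'I_d -> 'I_N},
  \sum_(e in S) c e * \prod_j v j e 0 (i j) == 0].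

Lemma zerosumP S : reflect (forall i : {ffun 'I_d -> 'I_N},
  \sum_(e in S) c e * \prod_j v j e 0 (i j) = 0) (zerosum S).
Proof. by apply: (iffP forallP) => h i; apply/eqP. Qed.

(** The empty set qualifies too, so uses carry a separate nonemptiness or size condition. *)
Definition minzerosum T := zerosum T /\
  forall S, S != set0 -> S \proper T -> ~~ zerosum S.

Lemma modespanS j S T : S \subset T -> (modespan j S <= modespan j T)%MS.
Proof.
move=> /fintype.subsetP ST; apply/sumsmx_subP => e eS.
by rewrite (sumsmx_sup e) ?ST.
Qed.

Lemma modespan_mem j S e : e \in S -> (v j e <= modespan j S)%MS.
Proof. by move=> eS; rewrite (sumsmx_sup e) ?genmxE. Qed.

Lemma modespanU j S T : (modespan j (S :|: T) :=: modespan j S + modespan j T)%MS.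
Proof.
apply/eqmxP/andP; split; last by rewrite addsmx_sub !modespanS ?subsetUl ?subsetUr.
apply/sumsmx_subP => e; rewrite inE genmxE => /orP[] /(modespan_mem j) h.
  exact: submx_trans h (addsmxSl _ _).
exact: submx_trans h (addsmxSr _ _).
Qed.

Lemma rank_modespan_le j S : (\rank (modespan j S) <= #|S|)%N.
Proof.
rewrite -sum1_card; apply: leq_trans (mxrank_sum_leqif _).1 _ => /=.
by apply: leq_sum => e _; rewrite genmxE rank_leq_row.
Qed.

(** Apply the tensor product of the maps [P j] to the zero sum: the terms of [S] are unchanged, and
    each term of [Q] acquires a zero factor in some mode. *)
Lemma zerosum_project S Q (P : 'I_d -> 'M[F]_N) :
  [disjoint S & Q] -> zerosum (S :|: Q) ->
  (forall j, {in S, forall e, v j e *m P j = v j e}) ->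
  {in Q, forall e, exists j, v j e *m P j = 0} -> zerosum S.
Proof.
move=> dSQ /zerosumP zSQ fixS killQ; apply/zerosumP => i'.
(* A coordinate of the image of a product tensor is a product over modes of sums; it expands into a
   sum over multi-indices [i]. *)
have key e : \sum_(i : {ffun 'I_d -> 'I_N}) (\prod_j P j (i j) (i' j)) *
    (\prod_j v j e 0 (i j)) = \prod_j (v j e *m P j) 0 (i' j).
  under [RHS]eq_bigr do rewrite mxE.
  rewrite bigA_distr_bigA /=; apply: eq_bigr => i _.
  by rewrite -big_split /=; apply: eq_bigr => j _; rewrite mulrC.
have : \sum_(i : {ffun 'I_d -> 'I_N}) (\prod_j P j (i j) (i' j)) *
    (\sum_(e in S :|: Q) c e * \prod_j v j e 0 (i j)) = 0.
  by apply: big1 => i _; rewrite zSQ mulr0.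
under eq_bigr do rewrite mulr_sumr.
rewrite exchange_big /= (eq_bigl [predU S & Q]) => [|e]; last by rewrite !inE.
rewrite bigU //= [X in _ + X]big1 ?addr0 => [h|e eQ].
  rewrite -[RHS]h; apply: eq_bigr => e eS; under [RHS]eq_bigr do rewrite mulrCA.
  rewrite -mulr_sumr key; congr (_ * _).
  by apply: eq_bigr => j _; rewrite fixS.
under eq_bigr do rewrite mulrCA.
rewrite -mulr_sumr key; have [j ej] := killQ e eQ.
by rewrite (bigD1 j) //= ej mxE mul0r mulr0.
Qed.

Lemma minzerosum_extend T S : minzerosum T -> S != set0 -> S \proper T ->
  exists Q, [/\ Q != set0, Q \subset T :\: S &
    (\sum_(j < d) \rank (modespan j (S :|: Q)) < \sum_(j < d) \rank (modespan j S) + #|Q|)%N].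
Proof.
move=> [zT minT] S0 ST.
pose good Q := [&& Q != set0, Q \subset T :\: S &
    (\sum_(j < d) \rank (modespan j (S :|: Q)) < \sum_(j < d) \rank (modespan j S) + #|Q|)%N].
have [/existsP[Q /and3P[]]|] := boolP [exists Q, good Q]; first by exists Q.
move=> /existsPn noQ; exfalso; move: (minT S S0 ST) => /negP; apply.
(* The ground set has one copy of each tensor per mode, and [rk] adds up the mode ranks in the
   presence of [S]. Choosing a copy of [e] thus means choosing a mode for [e]. *)
pose sec (j : 'I_d) (B : {set E * 'I_d}) := [set e | (e, j) \in B].
pose rk (B : {set E * 'I_d}) := (\sum_(j < d) \rank (modespan j (S :|: sec j B)))%N.
have rk_mono : {homo rk : A B / A \subset B >-> (A <= B)%N}.
  move=> A B /fintype.subsetP AB; apply: leq_sum => j _; apply/mxrankS/modespanS.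
  by apply/setUS/fintype.subsetP => e; rewrite !inE => /AB.
have rk_submod A B : (rk (A :|: B) + rk (A :&: B) <= rk A + rk B)%N.
  rewrite -!big_split /=; apply: leq_sum => j _.
  rewrite -(mxrank_sum_cap (modespan j (S :|: sec j A))).
  have -> : S :|: sec j (A :|: B) = (S :|: sec j A) :|: (S :|: sec j B).
    by apply/setP => e; rewrite !inE; case: (e \in S).
  rewrite modespanU leq_add2l mxrankS // sub_capmx.
  by rewrite !modespanS //; apply: setUS; apply/fintype.subsetP => e; rewrite !inE => /andP[].
have [|B [BA B1 hB]] := @rado _ _ rk (\sum_(j < d) \rank (modespan j S))%N
    (T :\: S) rk_mono rk_submod (fun e => [set (e, j) | j : 'I_d]).
  (* For nonempty [J], Hall's condition is the failure of [good J]. *)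
  move=> J JQ; have [->|J0] := eqVneq J set0.
    by rewrite cards0 add0n; apply: leq_sum => j _; rewrite mxrankS ?modespanS ?subsetUl.
  have := noQ J; rewrite /good J0 JQ /= -leqNgt addnC => /leq_trans; apply.
  apply: leq_sum => j _; apply/mxrankS/modespanS/setUS/fintype.subsetP => e eJ.
  by rewrite inE; apply/bigcupP; exists e => //; apply/imsetP; exists j.
pose Qs (j : 'I_d) := sec j (\bigcup_(e in T :\: S) B e).
have QsE j e : e \in Qs j -> e \in T :\: S /\ (e, j) \in B e.
  rewrite inE => /bigcupP[e' e'Q eB]; have /fintype.subsetP/(_ _ eB) := BA e'.
  by move=> /imsetP[j' _ [? _]]; subst e'.
(* If [B e] were empty, the condition on the singleton of [e] would put the total rank of [S]
   strictly above itself. *)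
have cover e : e \in T :\: S -> exists j, e \in Qs j.
  move=> eQ; have := hB [set e]; rewrite sub1set eQ => /(_ isT).
  rewrite cards1 big_set1; have [->|/set0Pn[[e' j] ejB]] := eqVneq (B e) set0.
    suff -> : rk set0 = (\sum_(j < d) \rank (modespan j S))%N by rewrite add1n ltnn.
    apply: eq_bigr => j _; congr (\rank (modespan j _)).
    by apply/setP => x; rewrite !inE orbF.
  move=> _; have /fintype.subsetP/(_ _ ejB)/imsetP[j' _ [? _]] := BA e; subst e'.
  by exists j; rewrite inE; apply/bigcupP; exists e.
have sumQs : (\sum_(j < d) #|Qs j| <= #|T :\: S|)%N.
  rewrite -sum1_card (eq_bigr (fun j => \sum_(e in Qs j) 1)%N) => [|j _]; last by rewrite sum1_card.
  rewrite (exchange_big_dep (mem (T :\: S))) /=; last by move=> j e _ /QsE[].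
  apply: leq_sum => e eQ; apply: leq_trans (B1 e eQ).
  rewrite sum1_card -(card_imset [pred j | e \in Qs j] (f := pair e)); last by move=> ? ? [].
  by apply/subset_leq_card/fintype.subsetP => _ /imsetP[j ejQ ->]; case/QsE: ejQ.
have rkQ : (#|T :\: S| + \sum_(j < d) \rank (modespan j S) <=
   \sum_(j < d) \rank (modespan j S + modespan j (Qs j))%MS)%N.
  apply: leq_trans (hB _ (subxx _)) _; rewrite /rk.
  by apply: leq_sum => j _; rewrite modespanU.
(* The sets [Qs j] have total size at most [#|T :\: S|], yet raise the total rank by at least that
   much. So no mode loses any rank, and the two spans meet trivially. *)
have cap0 j : (modespan j S :&: modespan j (Qs j) = 0)%MS.
  apply/eqP; rewrite -mxrank_eq0.
  have hcap k := mxrank_sum_cap (modespan k S) (modespan k (Qs k)).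
  have := eq_bigr (P := predT) (r := index_enum 'I_d) (op := addn) (idx := 0%N)
    _ (fun k _ => hcap k).
  rewrite !big_split /= => hs.
  have : (\sum_(k < d) \rank (modespan k (Qs k)) <= \sum_(k < d) #|Qs k|)%N.
    by apply: leq_sum => k _; apply: rank_modespan_le.
  have : (\rank (modespan j S :&: modespan j (Qs j))%MS <= \sum_(k < d) \rank (modespan k S :&: modespan k (Qs k))%MS)%N.
    by rewrite (bigD1 j) //= leq_addr.
  move=> capS rkQs; rewrite -leqn0; apply: leq_trans capS _.
  rewrite -(leq_add2l (\sum_(k < d) \rank (modespan k S + modespan k (Qs k))%MS)) hs addn0.
  by apply: leq_trans rkQ; rewrite addnC leq_add2r; apply: leq_trans rkQs sumQs.
apply: (@zerosum_project S (T :\: S) (fun j => proj_mx (modespan j S) (modespan j (Qs j)))).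
- by rewrite -setI_eq0; apply/eqP/setP => e; rewrite !inE; case: (e \in S).
- have -> // : S :|: T :\: S = T.
  apply/setP => e; rewrite !inE; have [eS|//] := boolP (e \in S).
  by rewrite (fintype.subsetP (proper_sub ST)).
- by move=> j e eS; rewrite proj_mx_id ?modespan_mem.
- by move=> e /cover[j eQ]; exists j; rewrite proj_mx_0 ?modespan_mem.
Qed.

Theorem minzerosum_rank T : minzerosum T -> (1 < #|T|)%N ->
  (\sum_(j < d) \rank (modespan j T) + 2 <= #|T| + d)%N.
Proof.
move=> mT T1.
(* The invariant, that the sum of (rank - 1) is at most [#|S| - 1], holds for singletons. An
   enlargement adds less rank than elements, so the one that reaches [T] yields [#|T| - 2]. *)
suff grow n S : (#|T :\: S| <= n)%N -> S != set0 -> S \proper T ->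
    (\sum_(j < d) \rank (modespan j S) + 1 <= #|S| + d)%N ->
    (\sum_(j < d) \rank (modespan j T) + 2 <= #|T| + d)%N.
  have /card_gt0P[e eT] : (0 < #|T|)%N by lia.
  apply: (grow #|T :\: [set e]| [set e]) => //.
  - by apply/set0Pn; exists e; rewrite inE.
  - by rewrite properEcard sub1set eT cards1.
  - rewrite cards1 addnC leq_add2l; apply: leq_trans (_ : \sum_(j < d) 1 <= _)%N; last by rewrite sum1_card card_ord.
    by apply: leq_sum => j _; rewrite (leq_trans (rank_modespan_le _ _)) ?cards1.
elim: n S => [|n IHn] S.
  by rewrite leqn0 cards_eq0 setD_eq0 => TS _ /proper_subn; rewrite TS.
move=> leTS S0 ST hS.
have [Q [Q0 QT hQ]] := minzerosum_extend mT S0 ST.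
have dSQ : [disjoint S & Q].
  rewrite disjoint_sym; apply: disjointWl QT _.
  by rewrite -setI_eq0; apply/eqP/setP => e; rewrite !inE; case: (e \in S); rewrite ?andbF.
have SQT : S :|: Q \subset T.
  by rewrite subUset (proper_sub ST) (subset_trans QT) ?subsetDl.
have := cardsUI S Q; have /eqP -> : S :&: Q == set0 by rewrite setI_eq0.
rewrite cards0 addn0 => cSQ.
have [SQ|SQ] := eqVneq (S :|: Q) T.
  by rewrite -{1}SQ -SQ cSQ; lia.
apply: (IHn (S :|: Q)); last by rewrite cSQ; lia.
- rewrite -ltnS; apply: leq_trans leTS; apply: proper_card.
  rewrite properE setDS ?subsetUl //=.
  have /set0Pn[e eQ] := Q0; apply/fintype.subsetPn; exists e; first exact: (fintype.subsetP QT).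
  by rewrite !inE eQ orbT.
- by rewrite setU_eq0 negb_and S0.
- by rewrite properEneq SQ.
Qed.

End ZeroSum.

(** * Kruskal's theorem *)

(** Carries the Kruskal condition from all [r] terms to [p] of them: it is applied with
    [t j = k j - 1], [n = r - 1] and [m = p - 1]. *)
Lemma sum_minn_ge (d : nat) (t : 'I_d -> nat) (n m : nat) :
  (0 < m <= n)%N -> (forall j, t j <= n)%N -> (2 * n < \sum_(j < d) t j)%N ->
  (2 * m < \sum_(j < d) minn (t j) m)%N.
Proof.
elim: n t => [|n IHn] t /andP[m0 mn] tn sumt; first lia.
have [mE|mNE] := eqVneq m n.+1.
  rewrite (eq_bigr t) ?mE // => j _; exact/minn_idPl.
rewrite (eq_bigr (fun j => minn (minn (t j) n) m)) => [|j _]; last lia.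
apply: IHn => [|j|]; [lia|lia|].
(* Capping at n loses one for each j in C; if #|C| >= 3, the terms in C alone
   are large enough. *)
pose C := [set j | t j == n.+1].
have sumE : (\sum_(j < d) t j = \sum_(j < d) minn (t j) n + #|C|)%N.
  rewrite -sum1_card [X in (_ + X)%N]big_mkcond -big_split /=; apply: eq_bigr => j _.
  by rewrite inE; have := tn j; case: eqP => h; lia.
have [C2|C3] := leqP #|C| 2; first lia.
have : (\sum_(j in C) n <= \sum_(j < d) minn (t j) n)%N.
  rewrite [leqRHS](bigID (mem C)) /=; apply: leq_trans (leq_addr _ _).
  by apply: leq_sum => j; rewrite inE => /eqP ->; lia.
by rewrite sum_nat_const; nia.
Qed.

Lemma exists_subset_card (T : finType) (A : {set T}) (n : nat) :
  (n <= #|A|)%N -> exists2 B : {set T}, B \subset A & #|B| = n.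
Proof.
move=> nA; exists [set x in take n (enum A)].
  by apply/fintype.subsetP => x; rewrite inE => /mem_take; rewrite mem_enum.
rewrite cardsE (card_uniqP _) ?take_uniq ?enum_uniq // size_take -cardE.
by case: ltngtP nA.
Qed.

Lemma exists_superset_card (T : finType) (A : {set T}) (n : nat) :
  (#|A| <= n <= #|T|)%N -> exists2 B : {set T}, A \subset B & #|B| = n.
Proof.
move=> /andP[An nT].
have [|B BA Bn] := @exists_subset_card T (~: A) (#|T| - n)%N.
  by rewrite cardsCs finset.setCK; lia.
exists (~: B); first by rewrite subsetC.
by rewrite cardsCs finset.setCK Bn; lia.
Qed.

Section Kruskal.
Variables (F : fieldType) (d N r r' : nat).
(** [inl] indexes the given decomposition and [inr] the rival one; the coefficients are to be signed
    so that the whole family sums to zero. *)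
Variables (v : 'I_d -> 'I_r + 'I_r' -> 'rV[F]_N) (c : 'I_r + 'I_r' -> F).
Variable k : 'I_d -> nat.
Hypothesis k_bound : forall j, (0 < k j <= r)%N.
Hypothesis k_indep : forall j (S : {set 'I_r}), (#|S| <= k j)%N ->
  (#|S| <= \rank (modespan v j (inl @: S)))%N.
(** Subtraction-free form of the bound [2r - 1] on the sum of the [k j - 1]. *)
Hypothesis k_sum : (2 * r + d <= \sum_(j < d) k j + 1)%N.
Hypothesis c_neq0 : forall p, c (inl p) != 0.

Let zs := zerosum v c.
Implicit Types T U : {set 'I_r + 'I_r'}.
Let lpart T : {set 'I_r} := [set a | inl a \in T].
Let rpart T : {set 'I_r'} := [set b | inr b \in T].

Let card_parts T : #|T| = (#|lpart T| + #|rpart T|)%N.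
Proof.
by rewrite -!sum1_card big_sumType /=; congr addn; apply: eq_bigl => x; rewrite inE.
Qed.

(** As [k j > 0], every factor of an old term is nonzero; a nonzero coordinate in each mode gives a
    nonzero coordinate of the tensor. *)
Let single_nonzero a : ~~ zs [set inl a].
Proof.
have v0 j : exists i, v j (inl a) 0 i != 0.
  apply/existsP; apply: contraTT (k_bound j) => /existsPn v0.
  have va0 : v j (inl a) = 0 by apply/rowP => i; rewrite mxE; apply/eqP/negPn/v0.
  have := @k_indep j [set a]; rewrite imset_set1 cards1 /modespan big_set1 va0.
  by rewrite genmx0 mxrank0; case: (k j) => // n /(_ isT).
apply/negP => /zerosumP/(_ [ffun j => xchoose (v0 j)])/eqP.
rewrite big_set1 mulf_eq0 (negbTE (c_neq0 a)) /= => /prodf_eq0[j _].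
by rewrite ffunE; apply/negP; exact: xchooseP (v0 j).
Qed.

Let minzerosum_pair T : minzerosum v c T -> (0 < #|lpart T|)%N ->
  (#|rpart T| <= #|lpart T|)%N -> #|lpart T| = 1%N /\ #|rpart T| = 1%N.
Proof.
move=> mT p0 qp; have [p1|p1] := leqP #|lpart T| 1.
  have {p0 p1}p1 : #|lpart T| = 1%N by lia.
  (* Without a new term, [T] would consist of one nonzero tensor. *)
  split=> //; case: (posnP #|rpart T|) => [q0|]; last lia.
  have /eqP/cards1P[a Ta] := p1; have := single_nonzero a; case: mT => + _.
  suff -> : T = [set inl a] by move=> zT; rewrite /zs zT.
  apply/setP => -[x|x]; rewrite inE.
    by have /setP/(_ x) := Ta; rewrite !inE => ->.
  by have /eqP := q0; rewrite cards_eq0 => /eqP/setP/(_ x); rewrite !inE => ->.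
have T2 : (1 < #|T|)%N by rewrite card_parts; lia.
have := minzerosum_rank mT T2; rewrite card_parts.
(* The left side is the minimum of [k j] and p, the number of old terms, written with predecessors
   to fit [sum_minn_ge]. Summed over modes, it bounds the sum of min(k j - 1, p - 1) by p + q - 2,
   hence by 2(p - 1). *)
have rank_ge j : (minn (k j).-1 #|lpart T|.-1 + 1 <= \rank (modespan v j T))%N.
  have [|S SL Scard] := @exists_subset_card _ (lpart T) (minn (k j) #|lpart T|).
    by rewrite geq_minr.
  have SkS : (#|S| <= k j)%N by rewrite Scard geq_minl.
  apply: leq_trans (_ : #|S| <= _)%N; first by have := k_bound j; lia.
  apply: leq_trans (k_indep SkS) _; apply/mxrankS/modespanS.
  apply/fintype.subsetP => _ /imsetP[a aS ->].
  by have := fintype.subsetP SL a aS; rewrite inE.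
have pr : (#|lpart T| <= r)%N by rewrite -[r in leqRHS]card_ord max_card.
have sum1_d : (\sum_(j < d) 1 = d)%N by rewrite sum1_card card_ord.
have ksum : (\sum_(j < d) k j = \sum_(j < d) (k j).-1 + d)%N.
  rewrite -[X in (_ + X)%N]sum1_d -big_split /=; apply: eq_bigr => j _.
  by have := k_bound j; lia.
have := @sum_minn_ge d (fun j => (k j).-1) r.-1 #|lpart T|.-1.
have : (\sum_(j < d) (minn (k j).-1 #|lpart T|.-1 + 1) <= \sum_(j < d) \rank (modespan v j T))%N.
  exact: leq_sum.
rewrite big_split /= sum1_d => h1 h2 h3.
have : (2 * #|lpart T|.-1 < \sum_(j < d) minn (k j).-1 #|lpart T|.-1)%N.
  apply: h2 => [|j|]; first by rewrite -!subn1 subn_gt0 p1 leq_sub2r.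
    by clear -k_bound; have := k_bound j; lia.
  have : (0 < r)%N := leq_trans (ltnW p1) pr.
  by move: k_sum; rewrite ksum; move: (\sum_(j < d) _)%N => X; clear; lia.
move: h1 h3 qp p1; move: (\sum_(j < d) minn _ _)%N (\sum_(j < d) \rank _)%N.
by move: #|lpart T| #|rpart T| => p q X Y; clear; lia.
Qed.

Let exists_minzerosum U : zs U -> U != set0 ->
  exists2 T, minzerosum v c T & (T != set0) && (T \subset U).
Proof.
have [n] := ubnP #|U|; elim: n U => // n IHn U leU zU U0.
have [/existsP[S /and3P[S0 SU zS]]|] :=
    boolP [exists S : {set _}, [&& S != set0, S \proper U & zs S]].
  have [|T mT /andP[T0 TS]] := IHn S _ zS S0.
    by apply: leq_trans (proper_card SU) _.
  by exists T; rewrite // T0 (subset_trans TS (proper_sub SU)).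
move=> /existsPn noS; exists U; rewrite ?U0 ?subxx //; split=> // S S0 SU.
by have := noS S; rewrite S0 SU.
Qed.

Let zerosumD T U : zs T -> zs U -> T \subset U -> zs (U :\: T).
Proof.
move=> /zerosumP zT /zerosumP zU TU; apply/zerosumP => i.
by have := zU i; rewrite (big_setID T) /= (finset.setIidPr TU) zT add0r.
Qed.

(* s is option-valued because 'I_r' may be empty, e.g. when U = set0. *)
Let zerosum_match U : zs U -> (#|lpart U| <= #|rpart U|)%N /\
  (#|lpart U| = #|rpart U| -> exists s : 'I_r -> option 'I_r',
     {in lpart U &, injective s} /\
     {in lpart U, forall a, exists2 b, s a = Some b &
       inr b \in U /\ zs [set inl a; inr b]}).
Proof.
have [n] := ubnP #|U|; elim: n U => // n IHn U leU zU.
have [->|U0] := eqVneq U set0.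
  have -> : lpart set0 = set0 by apply/setP => x; rewrite !inE.
  by rewrite cards0; split=> // _; exists (fun=> None); split=> [x y|x]; rewrite inE.
have [T mT /andP[T0 TU]] := exists_minzerosum zU U0.
have T0' : (0 < #|T|)%N by rewrite card_gt0.
have cD : #|U| = (#|T| + #|U :\: T|)%N by rewrite -(cardsID T U) (finset.setIidPr TU).
have [|leD matchD] := IHn (U :\: T) _ (zerosumD mT.1 zU TU); first lia.
have lD : #|lpart U| = (#|lpart T| + #|lpart (U :\: T)|)%N.
  rewrite -(cardsID (lpart T)); congr (_ + _)%N; apply: eq_card => x; rewrite !inE //.
  by case: (boolP (inl x \in T)) => [/(fintype.subsetP TU) ->|]; rewrite ?andbF.
have rD : #|rpart U| = (#|rpart T| + #|rpart (U :\: T)|)%N.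
  rewrite -(cardsID (rpart T)); congr (_ + _)%N; apply: eq_card => x; rewrite !inE //.
  by case: (boolP (inr x \in T)) => [/(fintype.subsetP TU) ->|]; rewrite ?andbF.
(* A minimal set with old terms and no more new than old ones is a pair, hence balanced. *)
have leT : (#|lpart T| <= #|rpart T|)%N.
  case/orP: (leq_total #|lpart T| #|rpart T|) => [//|qp].
  have [p0|p0] := posnP #|lpart T|; first exact: leq_trans (eq_leq p0) _.
  by have [p1 q1] := minzerosum_pair mT p0 qp; rewrite (leq_trans (eq_leq p1)) ?q1.
split; first by rewrite lD rD leq_add.
move=> eqU.
(* The inequality holds for [T] and for the rest, so equality for [U] forces equality in both. *)
have [eqT eqD] : #|lpart T| = #|rpart T| /\ #|lpart (U :\: T)| = #|rpart (U :\: T)|.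
  move: eqU leD leT; rewrite lD rD; move: #|lpart T| #|rpart T|.
  by move: #|lpart (U :\: T)| #|rpart (U :\: T)|; clear; lia.
have p0 : (0 < #|lpart T|)%N by move: T0'; rewrite card_parts -eqT addnn double_gt0.
have [|p1 q1] := minzerosum_pair mT p0; first by rewrite eqT.
have [s [sinj sP]] := matchD eqD.
have /eqP/cards1P[a La] := p1; have /eqP/cards1P[b Rb] := q1.
have inlT x : (inl x \in T) = (x == a) by have /setP/(_ x) := La; rewrite !inE.
have inrT x : (inr x \in T) = (x == b) by have /setP/(_ x) := Rb; rewrite !inE.
have TE : T = [set inl a; inr b].
  by apply/setP => -[x|x]; rewrite ?inlT ?inrT !inE ?orbF.
exists (fun x => if x == a then Some b else s x).
have sD x : x \in lpart U -> x != a -> x \in lpart (U :\: T).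
  by rewrite !inE inlT => -> ->.
(* The partner [b] of [a] lies in [T], and all other partners lie outside [T]; this keeps the
   matching injective. *)
have sNb x : x \in lpart U -> x != a -> s x != Some b.
  move=> xU xa; have [b' -> [b'D _]] := sP x (sD x xU xa).
  by apply: contraTneq b'D => -[->]; rewrite inE inrT eqxx.
split=> [x y xU yU|x xU].
  have [->|xa] := eqVneq x a; have [->|ya] := eqVneq y a => //.
  - by move=> /esym/eqP; rewrite (negbTE (sNb y yU ya)).
  - by move=> /eqP; rewrite (negbTE (sNb x xU xa)).
  - by apply: sinj; apply: sD.
have [->|xa] := eqVneq x a.
  exists b => //; rewrite -TE; split; last exact: mT.1.
  by apply: (fintype.subsetP TU); rewrite inrT.
have [b' sx [b'D zb']] := sP x (sD x xU xa).
by exists b' => //; split=> //; move: b'D; rewrite inE => /andP[].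
Qed.

Theorem kruskal : zs setT -> (r <= r')%N /\
  (r = r' -> exists s : 'I_r -> option 'I_r', injective s /\
     forall a, exists2 b, s a = Some b & zs [set inl a; inr b]).
Proof.
move=> /zerosum_match.
have -> : #|lpart setT| = r by rewrite -[RHS]card_ord -cardsT; apply: eq_card => x; rewrite !inE.
have -> : #|rpart setT| = r' by rewrite -[RHS]card_ord -cardsT; apply: eq_card => x; rewrite !inE.
move=> [le_r match_r]; split=> // /match_r[s [sinj sP]]; exists s; split.
  by move=> x y; apply: sinj; rewrite !inE.
by move=> a; have [|b sb [_ zb]] := sP a; [rewrite !inE|exists b].
Qed.

End Kruskal.

From mathcomp Require Import all_classical all_reals all_analysis.
From mathcomp Require Import measurable_realfun complex.
Import Order.TTheory GRing.Theory Num.Theory.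
Import numFieldNormedType.Exports.
Local Open Scope classical_set_scope.
Local Open Scope ring_scope.

(** * Gram matrices of square-integrable functions *)

Section ComplexIntegral.
Context (R : realType) (disp : measure_display) (T : measurableType disp)
        (mu : {measure set T -> \bar R}).
Local Notation C := R[i].
Local Notation Re := (@complex.Re R).
Local Notation Im := (@complex.Im R).

Definition cintegrable (h : T -> C) : Prop :=
  mu.-integrable setT (EFin \o (Re \o h)) /\ mu.-integrable setT (EFin \o (Im \o h)).

Definition cint (h : T -> C) : C :=
  Complex (Rintegral mu setT (Re \o h)) (Rintegral mu setT (Im \o h)).

Lemma ReD (x y : C) : Re (x + y) = Re x + Re y.
Proof. by case: x y => [? ?] [? ?]. Qed.

Lemma ReM (x y : C) : Re (x * y) = Re x * Re y - Im x * Im y.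
Proof. by case: x y => [? ?] [? ?]. Qed.

Lemma Re_sum (J : Type) (s : seq J) (P : pred J) (F : J -> C) :
  Re (\sum_(j <- s | P j) F j) = \sum_(j <- s | P j) Re (F j).
Proof. exact: (big_morph _ ReD erefl). Qed.

Lemma csqabsE (z : C) : csqabs z = Re (z * z^*).
Proof. by case: z => a b; rewrite /csqabs ReM /= mulrN opprK !expr2. Qed.

Lemma csqabs_ge0 (z : C) : 0 <= csqabs z.
Proof. by rewrite addr_ge0 ?sqr_ge0. Qed.

Lemma csqabs_eq0 (z : C) : (csqabs z == 0) = (z == 0).
Proof.
case: z => a b; rewrite /csqabs /= paddr_eq0 ?sqr_ge0 // !sqrf_eq0.
by rewrite eq_complex.
Qed.

Lemma L2innerE (u w : T -> C) : L2inner mu u w = cint (fun x => u x * (w x)^*).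
Proof.
congr Complex; apply: eq_Rintegral => x _ /=.
  by case: (u x) (w x) => [a b] [c e] /=; ring.
by case: (u x) (w x) => [a b] [c e] /=; ring.
Qed.

Lemma integral_Re_sum (J : finType) (a : J -> C) (h : J -> T -> C) :
  (forall j, cintegrable (h j)) ->
  (\int[mu]_x (Re (\sum_j a j * h j x))%:E)%E = (Re (\sum_j a j * cint (h j)))%:E.
Proof.
move=> hint; under eq_integral do rewrite Re_sum -sumEFin.
have intj j : mu.-integrable setT (fun x => (Re (a j * h j x))%:E).
  have [h1 h2] := hint j.
  apply: (@eq_integrable _ _ _ mu setT measurableT
    (fun x => (Re (a j))%:E * (Re (h j x))%:E - (Im (a j))%:E * (Im (h j x))%:E)%E).
    by move=> x _; rewrite ReM EFinB !EFinM.
  by apply: integrableB => //; apply: integrableZl.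
rewrite integral_sum // Re_sum -sumEFin; apply: eq_bigr => j _.
have [h1 h2] := hint j; rewrite ReM /=.
under eq_integral do rewrite ReM EFinB !EFinM.
rewrite integralB //; [|exact: integrableZl..].
rewrite !integralZl // EFinB !EFinM /Rintegral !fineK //.
  exact: integrable_fin_num h2.
exact: integrable_fin_num h1.
Qed.

(** Both the real and the imaginary part of the product are dominated by the sum of the squared
    moduli of [u] and [w]. *)
Lemma inL2_cintegrable (u w : T -> C) : inL2 mu u -> inL2 mu w ->
  cintegrable (fun x => u x * (w x)^*).
Proof.
move=> [mu1 mu2 ufin] [mw1 mw2 wfin].
have sqint (z : T -> C) : measurable_fun setT (Re \o z) -> measurable_fun setT (Im \o z) ->
    (L2sqnorm mu z < +oo)%E -> mu.-integrable setT (fun x => (csqabs (z x))%:E).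
  move=> m1 m2 zfin; apply/integrableP; split.
    by apply/measurable_EFinP/measurable_funD; apply: measurable_funX.
  by under eq_integral do rewrite abse_EFin ger0_norm ?csqabs_ge0 //.
have dom := integrableD measurableT (sqint u mu1 mu2 ufin) (sqint w mw1 mw2 wfin).
split; apply: (le_integrable measurableT _ _ dom) => [|x _].
- apply/measurable_EFinP.
  rewrite (_ : _ \o _ = fun x => Re (u x) * Re (w x) + Im (u x) * Im (w x)).
    by apply: measurable_funD; apply: measurable_funM.
  by apply/funext => x /=; case: (u x) (w x) => [a b] [c e] /=; ring.
- rewrite /= lee_fin; rewrite [leRHS](ger0_norm (addr_ge0 (csqabs_ge0 _) (csqabs_ge0 _))).
  case: (u x) (w x) => [a b] [c e] /=; rewrite /csqabs /= ler_norml.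
  have := (sqr_ge0 (a + c), sqr_ge0 (a - c), sqr_ge0 (b + e), sqr_ge0 (b - e)).
  have := (sqr_ge0 a, sqr_ge0 b, sqr_ge0 c, sqr_ge0 e).
  by move=> [[[? ?] ?] ?] [[[? ?] ?] ?]; apply/andP; split; lra.
- apply/measurable_EFinP.
  rewrite (_ : _ \o _ = fun x => Im (u x) * Re (w x) - Re (u x) * Im (w x)).
    by apply: measurable_funB; apply: measurable_funM.
  by apply/funext => x /=; case: (u x) (w x) => [a b] [c e] /=; ring.
- rewrite /= lee_fin; rewrite [leRHS](ger0_norm (addr_ge0 (csqabs_ge0 _) (csqabs_ge0 _))).
  case: (u x) (w x) => [a b] [c e] /=; rewrite /csqabs /= ler_norml.
  have := (sqr_ge0 (a + e), sqr_ge0 (a - e), sqr_ge0 (b + c), sqr_ge0 (b - c)).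
  have := (sqr_ge0 a, sqr_ge0 b, sqr_ge0 c, sqr_ge0 e).
  by move=> [[[? ?] ?] ?] [[[? ?] ?] ?]; apply/andP; split; lra.
Qed.

Lemma csqabs_sum (E : finType) (c t : E -> C) :
  csqabs (\sum_e c e * t e) =
  Re (\sum_(p : E * E) (c p.1 * (c p.2)^*) * (t p.1 * (t p.2)^*)).
Proof.
rewrite csqabsE rmorph_sum big_distrlr /= pair_bigA /=; congr Re.
by apply: eq_bigr => -[e f] _ /=; rewrite rmorphM mulrACA.
Qed.

Lemma L2sqnorm_sum (E : finType) (c : E -> C) (u : E -> T -> C) :
  (forall e, inL2 mu (u e)) ->
  L2sqnorm mu (fun x => \sum_e c e * u e x) =
  (Re (\sum_(p : E * E) (c p.1 * (c p.2)^*) * L2inner mu (u p.1) (u p.2)))%:E.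
Proof.
move=> u2; rewrite /L2sqnorm; under eq_integral do rewrite csqabs_sum.
rewrite (@integral_Re_sum _ (fun p : E * E => c p.1 * (c p.2)^*)
  (fun (p : E * E) x => u p.1 x * (u p.2 x)^*)); last first.
  by move=> p; apply: inL2_cintegrable.
by under [in RHS]eq_bigr do rewrite L2innerE.
Qed.

End ComplexIntegral.

Section GramFactor.
Variable (R : realType).
Local Notation C := R[i].

(** Diagonalise [G] by a unitary [P]. Each eigenvalue is the value of the form at a row of [P],
    hence nonnegative, and [V] is the adjoint of [P] with columns scaled by the square roots of the
    eigenvalues. *)
Lemma psd_factor (n : nat) (G : 'M[C]_n) : (forall i j, G j i = (G i j)^*) ->
  (forall c : 'rV[C]_n, 0 <= complex.Re (\sum_(p : 'I_n * 'I_n) (c 0 p.1 * (c 0 p.2)^*) * G p.1 p.2)) ->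
  exists V : 'M[C]_n, forall i j, G i j = \sum_l V i l * (V j l)^*.
Proof.
move=> Gherm Gpsd.
have Gh : G \is hermsymmx.
  apply/is_hermitianmxP; rewrite expr0 scale1r; apply/matrixP => i j.
  by rewrite !mxE; apply: Gherm.
have /orthomx_spectralP := hermitian_normalmx Gh.
set P := spectralmx G; set D := spectral_diag G => GE.
have Pu : P \is unitarymx := spectral_unitarymx G.
have D_ge0 l : 0 <= D 0 l.
  have Dr : D 0 l \is Num.real.
    by have /mxOverP := hermitian_spectral_diag_real Gh; apply.
  have DE : D 0 l = \sum_(p : 'I_n * 'I_n) (row l P 0 p.1 * (row l P 0 p.2)^*) * G p.1 p.2.
    have : P *m G *m (P^T ^ Num.conj)%sesqui = diag_mx D.
      rewrite {1}GE invmx_unitary // !mulmxA (unitarymxP Pu) mul1mx -mulmxA (unitarymxP Pu).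
      by rewrite mulmx1.
    move=> /matrixP/(_ l l); rewrite [RHS]mxE eqxx mulr1n => <-.
    rewrite -(pair_bigA _ (fun i j => (row l P 0 i * (row l P 0 j)^*) * G i j)) /=.
    rewrite mxE exchange_big /=; apply: eq_bigr => j _.
    rewrite !mxE mulr_suml; apply: eq_bigr => i _.
    by rewrite !mxE mulrAC.
  rewrite -(RRe_real Dr) ler0c DE; exact: Gpsd.
exists (\matrix_(i, l) ((P l i)^* * sqrtC (D 0 l))) => i j.
rewrite {1}GE invmx_unitary // mxE; apply: eq_bigr => l _.
rewrite mul_mx_diag !mxE rmorphM /= conjCK mulrACA.
rewrite (CrealP _ : (sqrtC _)^* = _) ?ger0_real ?sqrtC_ge0 // -expr2 sqrtCK.
by rewrite -!mulrA; congr (_ * _); rewrite mulrC.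
Qed.

End GramFactor.

Section Gram.
Context (R : realType).
Local Notation C := R[i].
Local Notation Re := (@complex.Re R).

Lemma gram_sum_csqabs (E I : finType) (c : E -> C) (t : E -> I -> C) :
  Re (\sum_(p : E * E) (c p.1 * (c p.2)^*) * (\sum_i t p.1 i * (t p.2 i)^*)) =
  \sum_i csqabs (\sum_e c e * t e i).
Proof.
under [RHS]eq_bigr do rewrite csqabs_sum.
rewrite -Re_sum exchange_big /=; congr Re.
by apply: eq_bigr => p _; rewrite mulr_sumr.
Qed.

Lemma sum_csqabs_eq0 (I : finType) (z : I -> C) :
  \sum_i csqabs (z i) = 0 <-> forall i, z i = 0.
Proof.
split=> [/psumr_eq0P z0 i|z0].
  by apply/eqP; rewrite -csqabs_eq0 z0 // => j _; apply: csqabs_ge0.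
by apply: big1 => i _; rewrite z0; apply/eqP; rewrite csqabs_eq0.
Qed.

Context (disp : measure_display) (T : measurableType disp)
        (mu : {measure set T -> \bar R}).

Lemma L2inner_conj (u w : T -> C) : inL2 mu u -> inL2 mu w ->
  L2inner mu w u = (L2inner mu u w)^*.
Proof.
move=> u2 w2; rewrite /L2inner; congr Complex.
  by apply: eq_Rintegral => x _; rewrite mulrC [X in _ + X]mulrC.
have [_ intI] := inL2_cintegrable u2 w2.
rewrite -mulN1r -RintegralZl //; last first.
  rewrite (_ : _ \o _ = EFin \o (@complex.Im R \o (fun x => u x * (w x)^*))) //.
  by apply/funext => x /=; congr EFin; case: (u x) (w x) => [a b] [c e] /=; ring.
by apply: eq_Rintegral => x _; ring.
Qed.

(** The quadratic form of the Gram matrix is a squared L^2 norm, hence nonnegative, so [psd_factor]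
    applies and the rows of its factor are the vectors. *)
Lemma gram_vectors (E : finType) (u : E -> T -> C) :
  (forall e, inL2 mu (u e)) ->
  exists V : E -> 'rV[C]_#|E|, forall e f,
    L2inner mu (u e) (u f) = \sum_l V e 0 l * (V f 0 l)^*.
Proof.
move=> u2.
pose G := \matrix_(i < #|E|, j < #|E|) L2inner mu (u (enum_val i)) (u (enum_val j)).
have [i j|c|V GV] := @psd_factor R _ G.
- by rewrite !mxE; apply: L2inner_conj.
- rewrite (eq_bigr (fun p => (c 0 p.1 * (c 0 p.2)^*) *
      L2inner mu (u (enum_val p.1)) (u (enum_val p.2)))) => [|p _]; last by rewrite mxE.
  rewrite -lee_fin -(L2sqnorm_sum (fun i => c 0 i) (fun i => u2 (enum_val i))).
  by apply: integral_ge0 => x _; rewrite lee_fin csqabs_ge0.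
exists (fun e => row (enum_rank e) V) => e f.
have := GV (enum_rank e) (enum_rank f); rewrite mxE !enum_rankK => ->.
by apply: eq_bigr => l _; rewrite !mxE.
Qed.

Lemma L2sqnorm_eq0 (E : finType) (n : nat) (u : E -> T -> C) (V : E -> 'rV[C]_n) (c : E -> C) :
  (forall e, inL2 mu (u e)) ->
  (forall e f, L2inner mu (u e) (u f) = \sum_l V e 0 l * (V f 0 l)^*) ->
  L2sqnorm mu (fun x => \sum_e c e * u e x) = 0%E <-> \sum_e c e *: V e = 0.
Proof.
move=> u2 uV; rewrite L2sqnorm_sum //; under eq_bigr do rewrite uV.
rewrite (gram_sum_csqabs c (fun e l => V e 0 l)).
split=> [[/sum_csqabs_eq0 h]|h].
  apply/rowP => l; rewrite summxE mxE -[RHS](h l).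
  by apply: eq_bigr => e _; rewrite mxE.
congr EFin; apply/sum_csqabs_eq0 => l.
have /rowP/(_ l) := h; rewrite summxE mxE => hl.
by rewrite -[RHS]hl; apply: eq_bigr => e _; rewrite mxE.
Qed.

End Gram.

(** * Kruskal rank and coherence of finite families in L^2 *)

Section LinIndep.
Context (R : realType) (disp : measure_display) (T : measurableType disp)
        (mu : {measure set T -> \bar R}) (r : nat).
Local Notation C := R[i].
Variable Phi : 'I_r -> T -> C.
Hypothesis Phi2 : forall p, inL2 mu (Phi p).
Implicit Type S : {set 'I_r}.

Lemma L2lin_indepP (n : nat) (V : 'I_r -> 'rV[C]_n) S :
  (forall p q, L2inner mu (Phi p) (Phi q) = \sum_l V p 0 l * (V q 0 l)^*) ->
  L2lin_indep mu S Phi <->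
  forall c : 'I_r -> C, \sum_(p in S) c p *: V p = 0 -> forall p, p \in S -> c p = 0.
Proof.
move=> PhiV; pose restr (c : 'I_r -> C) p := if p \in S then c p else 0.
have key c : L2sqnorm mu (fun x => \sum_(p in S) c p * Phi p x) = 0%E <->
    \sum_(p in S) c p *: V p = 0.
  have -> : (fun x => \sum_(p in S) c p * Phi p x) = (fun x => \sum_p restr c p * Phi p x).
    apply/funext => x; rewrite big_mkcond; apply: eq_bigr => p _.
    by rewrite /restr; case: ifP; rewrite ?mul0r.
  rewrite (L2sqnorm_eq0 (restr c) Phi2 PhiV) [X in _ <-> X = 0]big_mkcond /=.
  rewrite (eq_bigr (fun p => if p \in S then c p *: V p else 0)) // => p _.
  by rewrite /restr; case: ifP; rewrite ?scale0r.
by split=> h c /key; apply: h.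
Qed.

Lemma L2lin_indepS S S' : S \subset S' ->
  L2lin_indep mu S' Phi -> L2lin_indep mu S Phi.
Proof.
move=> SS' ind c c0 p pS.
pose c' q := if q \in S then c q else 0.
have := ind c' _ p (fintype.subsetP SS' p pS); rewrite /c' pS; apply.
rewrite -[RHS]c0; congr L2sqnorm; apply/funext => x.
rewrite (big_setID S) /= (finset.setIidPr SS') [X in _ + X]big1 => [|q]; last first.
  by rewrite inE => /andP[/negbTE -> _]; rewrite mul0r.
by rewrite addr0; apply: eq_bigr => q ->.
Qed.

Lemma L2krank_le : (L2krank mu Phi <= r)%N.
Proof. by apply/bigmax_leqP => i _; rewrite -ltnS. Qed.

(** [L2krank] tests only sets of one exact size, so a smaller set is first enlarged to that size. *)
Lemma L2krank_indep S : (#|S| <= L2krank mu Phi)%N -> L2lin_indep mu S Phi.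
Proof.
move=> SK.
have [|k0 /asboolP indk KE] := @eq_bigmax_cond _
   (fun k : 'I_r.+1 => `[< forall S : {set 'I_r}, #|S| = k -> L2lin_indep mu S Phi >]) (@nat_of_ord r.+1).
  (* The empty set makes 0 admissible, so the maximum is attained. *)
  apply/card_gt0P; exists ord0; apply/asboolP => S' /eqP.
  by rewrite cards_eq0 => /eqP -> c _ p; rewrite inE.
have [|B SB BK] := @exists_superset_card _ S (L2krank mu Phi).
  by rewrite SK card_ord L2krank_le.
by apply: L2lin_indepS SB _; apply: indk; rewrite BK.
Qed.

Lemma L2krank_dep : (L2krank mu Phi < L2dim_span mu Phi)%N ->
  exists2 S : {set 'I_r}, #|S| = (L2krank mu Phi).+1 & ~ L2lin_indep mu S Phi.
Proof.
(* This puts the successor of the Kruskal rank inside the index range of the maximum defining it. *)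
move=> Kdim; have Kr : (L2krank mu Phi < r)%N.
  apply: leq_trans Kdim _; apply/bigmax_leqP => S _.
  by rewrite -[leqRHS]card_ord max_card.
apply: contrapT => noS.
have : ((L2krank mu Phi).+1 <= L2krank mu Phi)%N; last by rewrite ltnn.
apply: (@leq_bigmax_cond _ _ (@nat_of_ord r.+1) (Ordinal (_ : (L2krank mu Phi).+1 < r.+1)%N)) => //.
apply/asboolP => S SK; apply: contrapT => depS; apply: noS; by exists S.
Qed.

Lemma coherence_ge0 : 0 <= L2coherence mu Phi.
Proof. exact: bigmax_ge_id. Qed.

Lemma le_coherence p q : p != q -> Normc.normc (L2inner mu (Phi p) (Phi q)) <= L2coherence mu Phi.
Proof.
move=> pq; rewrite /L2coherence.
apply: le_trans (le_bigmax _ _ p); exact: (le_bigmax_cond _ (fun q => Normc.normc (L2inner mu (Phi p) (Phi q)))).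
Qed.

Hypothesis Phi1 : forall p, L2sqnorm mu (Phi p) = 1%E.

Lemma L2inner_unit p : L2inner mu (Phi p) (Phi p) = 1.
Proof.
rewrite /L2inner; congr Complex.
  rewrite /Rintegral -[RHS]/(fine 1%E); congr fine; rewrite -[RHS](Phi1 p).
  by apply: eq_integral => x _; rewrite /csqabs !expr2.
rewrite /Rintegral (_ : (fun=> _) = cst 0%E) ?integral0 //.
by apply/funext => x; rewrite mulrC subrr.
Qed.

Lemma normc_sum (I : finType) (P : pred I) (z : I -> C) :
  Normc.normc (\sum_(i | P i) z i) <= \sum_(i | P i) Normc.normc (z i).
Proof.
elim/big_ind2: _ => // [|x1 x2 y1 y2 h1 h2]; first by rewrite Normc.normc0.
by apply: le_trans (le_normcD _ _) _; apply: lerD.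
Qed.

(* Pair a vanishing combination with the function carrying its largest
   coefficient. *)
Lemma dependent_coherence S : ~ L2lin_indep mu S Phi ->
  1 <= #|S|.-1%:R * L2coherence mu Phi.
Proof.
have [V PhiV] := gram_vectors Phi2.
move=> /(L2lin_indepP S PhiV)/existsNP[c /not_implyP[c0 /existsNP[q0 /not_implyP[q0S /eqP cq0]]]].
case: (@arg_maxP _ _ _ q0 (mem S) (fun q => Normc.normc (c q)) q0S) => q qS' qmax.
have {qS'}qS : q \in S by [].
have normc_ge0 (z : C) : 0 <= Normc.normc z by case: z => a b; apply: sqrtr_ge0.
have cq_gt0 : 0 < Normc.normc (c q).
  apply: lt_le_trans (qmax q0 q0S); rewrite lt_neqAle normc_ge0 andbT eq_sym.
  by apply: contra cq0 => /eqP/Normc.eq0_normc ->.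
have inner0 : \sum_(p in S) c p * L2inner mu (Phi p) (Phi q) = 0.
  under eq_bigr do rewrite PhiV mulr_sumr.
  rewrite exchange_big /= big1 // => l _.
  have /rowP/(_ l) := c0; rewrite summxE mxE => h.
  transitivity ((\sum_(p in S) (c p *: V p) 0 l) * (V q 0 l)^*); last by rewrite h mul0r.
  by rewrite mulr_suml; apply: eq_bigr => p _; rewrite mxE mulrA.
rewrite -(ler_pM2r cq_gt0) mul1r.
(* Unit norm isolates [c q]; each of the other [#|S| - 1] terms is at most the coherence times the
   modulus of [c q]. *)
have cqE : c q = - \sum_(p in S | p != q) c p * L2inner mu (Phi p) (Phi q).
  move: inner0; rewrite (bigD1 q qS) /= L2inner_unit mulr1.
  by move=> /eqP; rewrite addr_eq0 => /eqP.
rewrite [leLHS](congr1 (@Normc.normc R) cqE) normcN.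
apply: le_trans (normc_sum _ _) _.
apply: (@le_trans _ _ (\sum_(p in S | p != q) L2coherence mu Phi * Normc.normc (c q))).
  apply: ler_sum => p /andP[pS pq]; rewrite Normc.normcM mulrC.
  by apply: ler_pM => //; [apply: le_coherence|apply: qmax].
rewrite sumr_const -[leLHS]mulr_natl mulrA (_ : #|_| = #|S|.-1) //.
rewrite (cardsD1 q S) qS /=; apply: eq_card => p.
by rewrite !inE andbC.
Qed.

(** With K the Kruskal rank and m the coherence, [dependent_coherence] on K + 1 functions gives 1 <=
    K m; dividing by m and subtracting 1 yields the bound. *)
Lemma L2omega_le : (L2krank mu Phi < L2dim_span mu Phi)%N ->
  (0 < L2krank mu Phi)%N /\ L2omega mu Phi <= (L2krank mu Phi)%:R - 1.
Proof.
move=> /L2krank_dep[S SK /dependent_coherence]; rewrite SK /= => h.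
have K0 : (0 < L2krank mu Phi)%N.
  by rewrite lt0n; apply: contraTneq h => ->; rewrite mul0r ler10.
(* Zero coherence, where the division in [L2omega] would default to 0, is excluded by [h]. *)
have M0 : 0 < L2coherence mu Phi.
  rewrite lt_neqAle coherence_ge0 andbT eq_sym.
  by apply: contraTneq h => ->; rewrite mulr0 ler10.
split=> //; rewrite /L2omega ler_pdivrMr // mulrBl mul1r.
by rewrite lerD2r.
Qed.

End LinIndep.

Lemma lin_indep_rank (F : fieldType) (I E : finType) (n : nat) (f : I -> E)
    (V : E -> 'rV[F]_n) (S : {set I}) :
  (forall c : I -> F, \sum_(p in S) c p *: V (f p) = 0 -> forall p, p \in S -> c p = 0) ->
  (#|S| <= \rank (\sum_(e in f @: S) <<V e>>)%MS)%N.
Proof.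
move=> ind; pose M := \matrix_(i < #|S|) V (f (enum_val i)).
have Mfree : row_free M.
  apply: inj_row_free => w wM; apply/rowP => i; rewrite mxE.
  (* [enum_rank_in] requires a member of [S]; the index [i] supplies one. *)
  have [p0 p0S] : exists p, p \in S by exists (enum_val i); apply: enum_valP.
  pose c p := w 0 (enum_rank_in p0S p).
  have := ind c _ (enum_val i) (enum_valP i); rewrite /c enum_valK_in; apply.
  rewrite -[RHS]wM mulmx_sum_row big_enum_val /=.
  by apply: eq_bigr => j _; rewrite enum_valK_in rowK.
rewrite -(eqP Mfree); apply: mxrankS; apply/row_subP => i; rewrite rowK.
by apply: (sumsmx_sup (f (enum_val i))); rewrite ?genmxE // imset_f // enum_valP.
Qed.

(** * Norms of sums of product functions *)

Section Product.
Context (R : realType) (d : nat) (disp : 'I_d -> measure_display)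
        (T : forall k : 'I_d, measurableType (disp k))
        (mu : forall k : 'I_d, {measure set T k -> \bar R}).
Local Notation C := R[i].
Local Notation Re := (@complex.Re R).

(** Since the summands are products, each integration acts on a single factor and turns it into a
    number; the conditional records which variables have been integrated. *)
Lemma iint_prod (J : finType) (a : J -> C) (h : forall k, J -> T k -> C) :
  (forall k j, cintegrable (mu k) (h k j)) ->
  forall s x, uniq s ->
  iint mu s (fun x => (Re (\sum_j a j * \prod_(k < d) h k j (x k)))%:E) x =
  (Re (\sum_j a j * \prod_(k < d)
     (if k \in s then cint (mu k) (h k j) else h k j (x k))))%:E.
Proof.
move=> hint; elim=> [|k s IHs] x //= /andP[ks us].
(* All that is constant in the variable [k], with the inner integrals already evaluated. *)
pose b j := a j * \prod_(l < d | l != k)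
  (if l \in s then cint (mu l) (h l j) else h l j (x l)).
transitivity (\int[mu k]_y (Re (\sum_j b j * h k j y))%:E)%E.
  apply: eq_integral => y _; rewrite IHs //; congr (Re _)%:E.
  apply: eq_bigr => j _; rewrite (bigD1 k) //= (negbTE ks) dfwithin mulrCA mulrC.
  congr (_ * _ * _); apply: eq_bigr => l lk.
  by rewrite dfwithout // eq_sym.
rewrite integral_Re_sum //; congr (Re _)%:E; apply: eq_bigr => j _.
rewrite [in RHS](bigD1 k) //= mem_head [RHS]mulrCA [RHS]mulrC.
congr (_ * _ * _); apply: eq_bigr => l lk.
by rewrite inE (negbTE lk).
Qed.

Variables (E : finType) (n : nat) (u : forall k, E -> T k -> C)
  (V : 'I_d -> E -> 'rV[C]_n).
Arguments u : clear implicits.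
Hypothesis u2 : forall k e, inL2 (mu k) (u k e).
Hypothesis uV : forall k e f,
  L2inner (mu k) (u k e) (u k f) = \sum_l V k e 0 l * (V k f 0 l)^*.

(** A product of Gram entries over the modes is the inner product of the tensor products of the
    vectors, so the squared norm becomes a sum of squared moduli of tensor coordinates. *)
Lemma prod_sqnorm_eq0 (c : E -> C) :
  prod_sqnorm mu (fun x => \sum_e c e * \prod_(k < d) u k e (x k)) = 0%E <->
  forall i : {ffun 'I_d -> 'I_n}, \sum_e c e * \prod_k V k e 0 (i k) = 0.
Proof.
rewrite /prod_sqnorm.
have -> : (fun x : prodT T => (csqabs (\sum_e c e * \prod_(k < d) u k e (x k)))%:E) =
  (fun x => (Re (\sum_(p : E * E) (c p.1 * (c p.2)^*) *
     \prod_(k < d) (u k p.1 (x k) * (u k p.2 (x k))^*)))%:E).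
  apply/funext => x; rewrite csqabs_sum; congr (Re _)%:E; apply: eq_bigr => p _.
  by rewrite rmorph_prod -big_split.
rewrite (@iint_prod _ (fun p : E * E => c p.1 * (c p.2)^*)
   (fun k (p : E * E) y => u k p.1 y * (u k p.2 y)^*)); last first.
- exact: enum_uniq.
- by move=> k p; apply: inL2_cintegrable.
rewrite (_ : Re _ = \sum_(i : {ffun 'I_d -> 'I_n}) csqabs (\sum_e c e * \prod_k V k e 0 (i k))).
  by rewrite -sum_csqabs_eq0; split=> [[->]|->].
rewrite -(gram_sum_csqabs c (fun e (i : {ffun 'I_d -> 'I_n}) => \prod_k V k e 0 (i k))).
congr Re; apply: eq_bigr => p _; congr (_ * _).
under eq_bigr do rewrite mem_enum /= -L2innerE uV.
rewrite bigA_distr_bigA /=; apply: eq_bigr => i _.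
by rewrite rmorph_prod -big_split.
Qed.

Lemma zerosum_prod_sqnorm (c : E -> C) (S : {set E}) :
  zerosum V c S <->
  prod_sqnorm mu (fun x => \sum_(e in S) c e * \prod_(k < d) u k e (x k)) = 0%E.
Proof.
pose c' e := if e \in S then c e else 0.
have restrE (t : E -> C) : \sum_(e in S) c e * t e = \sum_e c' e * t e.
  by rewrite big_mkcond; apply: eq_bigr => e _; rewrite /c'; case: ifP; rewrite ?mul0r.
have -> : (fun x : prodT T => \sum_(e in S) c e * \prod_(k < d) u k e (x k)) =
  (fun x => \sum_e c' e * \prod_(k < d) u k e (x k)).
  by apply/funext => x; rewrite restrE.
rewrite prod_sqnorm_eq0; split=> [/zerosumP h i|h].
  by rewrite -restrE.
by apply/zerosumP => i; rewrite restrE.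
Qed.

End Product.

(** * Kruskal's theorem in L^2 and the coherence condition *)

Lemma kruskal_L2 (R : realType) (d : nat) (disp : 'I_d -> measure_display)
    (T : forall k : 'I_d, measurableType (disp k))
    (mu : forall k : 'I_d, {measure set T k -> \bar R})
    (r r' : nat) (lam : 'I_r -> R[i]) (lam' : 'I_r' -> R[i])
    (phi : forall k : 'I_d, 'I_r -> T k -> R[i])
    (psi : forall k : 'I_d, 'I_r' -> T k -> R[i]) :
  (forall p, lam p != 0) ->
  (forall k p, inL2 (mu k) (phi k p)) ->
  (forall k p, inL2 (mu k) (psi k p)) ->
  (forall k, 0 < L2krank (mu k) (phi k))%N ->
  (2 * r + d <= \sum_(k < d) L2krank (mu k) (phi k) + 1)%N ->
  L2eq mu (tsum lam' psi) (tsum lam phi) ->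
  (r <= r')%N /\
  (r = r' -> exists s : 'I_r -> option 'I_r', injective s /\
     forall p, exists2 q, s p = Some q &
       L2eq mu (tensor (lam' q) (fun k => psi k q))
               (tensor (lam p) (fun k => phi k p))).
Proof.
move=> lam0 phi2 psi2 K_gt0 K_sum eqf.
pose u k (e : 'I_r + 'I_r') := match e with inl p => phi k p | inr q => psi k q end.
(* With the minus sign on the old terms, the zero sum of a pair reads as the difference inside
   [L2eq]. *)
pose c (e : 'I_r + 'I_r') := match e with inl p => - lam p | inr q => lam' q end.
have u2 k e : inL2 (mu k) (u k e) by case: e => p; [apply: phi2|apply: psi2].
(* All modes receive vectors of the same length r + r', as [kruskal] works with a single
   dimension. *)
have [V uV] := choice (fun k => gram_vectors (u2 k)).
have zsE := zerosum_prod_sqnorm u2 uV c.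
have [||||| le_r match_r] := @kruskal _ d _ r r' V c (fun k => L2krank (mu k) (phi k)).
- by move=> k; rewrite K_gt0 L2krank_le.
- move=> k S /L2krank_indep ind; apply: lin_indep_rank.
  apply: (L2lin_indepP (phi2 k) (V := fun p => V k (inl p)) S _).1 ind => p q.
  exact: (uV k (inl p) (inl q)).
- exact: K_sum.
- by move=> p; rewrite oppr_eq0.
- apply/zsE; rewrite -[RHS]eqf; congr prod_sqnorm; apply/funext => x.
  under eq_bigl do rewrite inE.
  rewrite big_sumType /= addrC /tsum -sumrN; congr (_ + _).
  by apply: eq_bigr => p _; rewrite mulNr.
split=> // /match_r[s [s_inj sP]]; exists s; split=> // p.
have [q sq /zsE zpq] := sP p; exists q => //.
rewrite /L2eq -[RHS]zpq; congr prod_sqnorm; apply/funext => x.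
by rewrite big_setU1 ?inE //= big_set1 /tensor mulNr addrC.
Qed.

Theorem theorem5 (R : realType) (d : nat) (disp : 'I_d -> measure_display)
    (T : forall k : 'I_d, measurableType (disp k))
    (mu : forall k : 'I_d, {measure set T k -> \bar R})
    (r : nat) (lam : 'I_r -> R[i])
    (phi : forall k : 'I_d, 'I_r -> T k -> R[i]) :
  (forall k, sigma_finite setT (mu k)) ->
  (forall p, lam p != 0) ->
  (forall k p, inL2 (mu k) (phi k p)) ->
  (forall k p, L2sqnorm (mu k) (phi k p) = 1%E) ->
  (forall k, L2krank (mu k) (phi k) < L2dim_span (mu k) (phi k))%N ->
  (2 * r%:R - 1 <= \sum_(k < d) L2omega (mu k) (phi k)) ->
  (* r = rank f : no decomposition of f with fewer terms *)
  (forall (r' : nat) (lam' : 'I_r' -> R[i])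
          (psi : forall k : 'I_d, 'I_r' -> T k -> R[i]),
      (r' < r)%N -> (forall k p, inL2 (mu k) (psi k p)) ->
      ~ L2eq mu (tsum lam' psi) (tsum lam phi)) /\
  (* essential uniqueness *)
  (forall (lam' : 'I_r -> R[i]) (psi : forall k : 'I_d, 'I_r -> T k -> R[i]),
      (forall k p, inL2 (mu k) (psi k p)) ->
      (forall k p, L2sqnorm (mu k) (psi k p) = 1%E) ->
      L2eq mu (tsum lam' psi) (tsum lam phi) ->
      exists s : 'S_r, forall p,
        L2eq mu (tensor (lam' (s p)) (fun k => psi k (s p)))
                (tensor (lam p) (fun k => phi k p))).
Proof.
move=> _ lam0 phi2 phi1 krank_lt omega_ge.
have K k := L2omega_le (phi2 k) (phi1 k) (krank_lt k).
have K_gt0 k : (0 < L2krank (mu k) (phi k))%N by have [] := K k.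
have K_sum : (2 * r + d <= \sum_(k < d) L2krank (mu k) (phi k) + 1)%N.
  have : 2 * r%:R - 1 <= \sum_(k < d) ((L2krank (mu k) (phi k))%:R - 1) :> R.
    by apply: le_trans omega_ge _; apply: ler_sum => k _; have [] := K k.
  rewrite sumrB sumr_const card_ord => le_sum.
  by rewrite -(ler_nat R) natrD natrM [leRHS]natrD natr_sum; lra.
split=> [r' lam' psi lt_r psi2|lam' psi psi2 _] eqf.
  have [le_r _] := kruskal_L2 lam0 phi2 psi2 K_gt0 K_sum eqf.
  by move: lt_r; rewrite ltnNge le_r.
have [_ /(_ erefl)[s [s_inj sP]]] := kruskal_L2 lam0 phi2 psi2 K_gt0 K_sum eqf.
(* Every [s p] is some [Some q], so the default [p] is never taken and injectivity carries over; an
   injective self-map of ['I_r] is a permutation. *)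
have t_inj : injective (fun p => odflt p (s p)).
  move=> p q; have [p' sp _] := sP p; have [q' sq _] := sP q.
  by rewrite sp sq /= => pq; apply: s_inj; rewrite sp sq pq.
exists (perm t_inj) => p; rewrite permE /=.
by have [q -> ] := sP p.
Qed.
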